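(* Let $M$ be a finite-dimensional free $\mathbb{T}$-module equipped with a hyperbolic positive bicomplex scalar product, let $H:M\to M$ be a self-adjoint bicomplex linear operator that does not depend on time, let $\hbar>0$ be a real constant and let $t_0\in\mathbb{R}$. Then the solutions $t\mapsto|\psi(t)\rangle\in M$ ($t\in\mathbb{R}$) of $$\mathbf{i_1}\hbar\frac{d}{dt}|\psi(t)\rangle=H|\psi(t)\rangle$$ are given by $|\psi(t)\rangle=U(t,t_0)|\psi(t_0)\rangle$, where $|\psi(t_0)\rangle$ is any ket of $M$ and $$U(t,t_0)=\exp\left\{-\frac{\mathbf{i_1}}{\hbar}(t-t_0)H\right\}.$$
   Context: Bicomplex numbers: $\mathbb{T}$ is the commutative ring of elements $w=z_1+z_2\mathbf{i_2}$ with $z_1,z_2\in\mathbb{C}(\mathbf{i_1})=\{x+y\mathbf{i_1}: x,y\in\mathbb{R}\}$ (a copy of the complex field), where $\mathbf{i_1}^2=\mathbf{i_2}^2=-1$ and $\mathbf{i_1}\mathbf{i_2}=\mathbf{i_2}\mathbf{i_1}=\mathbf{j}$, so $\mathbf{j}^2=1$. Put $\mathbf{e_1}=(1+\mathbf{j})/2$, $\mathbf{e_2}=(1-\mathbf{j})/2$; every $w\in\mathbb{T}$ is uniquely $w=\mathbf{e_1}w_{\hat 1}+\mathbf{e_2}w_{\hat 2}$ with $w_{\hat 1},w_{\hat 2}\in\mathbb{C}(\mathbf{i_1})$. The conjugation $\dag_3$ is $w^{\dag_3}=\bar z_1-\bar z_2\mathbf{i_2}$, equivalently $w^{\dag_3}=\mathbf{e_1}\overline{w_{\hat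 1}}+\mathbf{e_2}\overline{w_{\hat 2}}$. $\mathbb{D}^+=\{\mathbf{e_1}x_1+\mathbf{e_2}x_2: x_1,x_2\in\mathbb{R},\ x_1,x_2\ge 0\}$. A finite-dimensional free $\mathbb{T}$-module is a $\mathbb{T}$-module with a finite basis (linearly independent generating set); its elements are called kets. As a set it is a finite-dimensional real vector space, and derivatives and convergence are taken in its usual topology. A bicomplex scalar product on $M$ is a map $(\cdot,\cdot):M\times M\to\mathbb{T}$ that is additive and $\mathbb{T}$-homogeneous in the second argument, satisfies $(|\psi\rangle,|\phi\rangle)=(|\phi\rangle,|\psi\rangle)^{\dag_3}$, and $(|\psi\rangle,|\psi\rangle)=0$ iff $|\psi\rangle=0$. It is hyperbolic positive if $(|\psi\rangle,|\psi\rangle)\in\mathbb{D}^+$ for all $|\psi\rangle$. A bicomplex linear operator is a $\mathbb{T}$-linear map $A:M\to M$; its adjoint $A^*$ is the unique operator with $(|\psi\rangle,A|\phi\rangle)=(A^*|\psi\rangle,|\phi\rangle)$ for all kets; $H$ is self-adjoint if $H^*=H$. The exponential of a bicomplex linear operator $A$ is $\exp\{A\}=I+\sum_{n=1}^\infty\frac{1}{n!}A^n$. *)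

(* Defs.v *)
From HB Require Import structures.
From mathcomp Require Import all_boot all_order all_algebra.
From mathcomp Require Import all_classical all_reals all_analysis.
From mathcomp Require Import ring.
From mathcomp Require Import complex.

Set Implicit Arguments.
Unset Strict Implicit.
Unset Printing Implicit Defensive.

Import Order.TTheory GRing.Theory Num.Theory.
Import numFieldNormedType.Exports.

Local Open Scope classical_set_scope.
Local Open Scope ring_scope.

(* [Bicomplex z1 z2] is z1 + z2 i2, with z1, z2 in C(i1) = R[i]. *)
Record bicomplex (R : realType) := Bicomplex { bc1 : R[i]; bc2 : R[i] }.

Section BicomplexRing.
Variable R : realType.
Implicit Types v w : bicomplex R.

Definition bc_pair w := (bc1 w, bc2 w).
Definition pair_bc (p : R[i] * R[i]) : bicomplex R := Bicomplex p.1 p.2.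
Lemma bc_pairK : cancel bc_pair pair_bc. Proof. by case. Qed.

HB.instance Definition _ := Choice.copy (bicomplex R) (can_type bc_pairK).

Definition addbc v w := Bicomplex (bc1 v + bc1 w) (bc2 v + bc2 w).
Definition oppbc w := Bicomplex (- bc1 w) (- bc2 w).
Definition mulbc v w :=
  Bicomplex (bc1 v * bc1 w - bc2 v * bc2 w) (bc1 v * bc2 w + bc2 v * bc1 w).

Lemma addbcA : associative addbc.
Proof. by move=> [a b] [c d] [e f]; rewrite /addbc /= !addrA. Qed.
Lemma addbcC : commutative addbc.
Proof. by move=> [a b] [c d]; congr Bicomplex; rewrite addrC. Qed.
Lemma add0bc : left_id (Bicomplex 0 0) addbc.
Proof. by move=> [a b]; rewrite /addbc /= !add0r. Qed.
Lemma addNbc : left_inverse (Bicomplex 0 0) oppbc addbc.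
Proof. by move=> [a b]; rewrite /addbc /= !addNr. Qed.

HB.instance Definition _ :=
  GRing.isZmodule.Build (bicomplex R) addbcA addbcC add0bc addNbc.

Lemma mulbcA : associative mulbc.
Proof. by move=> [a b] [c d] [e f]; congr Bicomplex => /=; ring. Qed.
Lemma mulbcC : commutative mulbc.
Proof. by move=> [a b] [c d]; congr Bicomplex => /=; ring. Qed.
Lemma mul1bc : left_id (Bicomplex 1 0) mulbc.
Proof. by move=> [a b]; congr Bicomplex => /=; ring. Qed.
Lemma mulbcDl : left_distributive mulbc addbc.
Proof. by move=> [a b] [c d] [e f]; congr Bicomplex => /=; ring. Qed.
Lemma onebc_neq0 : Bicomplex 1 0 != 0 :> bicomplex R.
Proof. by apply/eqP => -[/eqP]; rewrite oner_eq0. Qed.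

HB.instance Definition _ := GRing.Zmodule_isComNzRing.Build (bicomplex R)
  mulbcA mulbcC mul1bc mulbcDl onebc_neq0.

Definition realbc (x : R) : bicomplex R := Bicomplex x%:C%C 0.
Definition ii1 : bicomplex R := Bicomplex 'i%C 0.
Definition ii2 : bicomplex R := Bicomplex 0 1.
Definition jj : bicomplex R := ii1 * ii2.
Definition ee1 : bicomplex R := realbc 2^-1 * (1 + jj).
Definition ee2 : bicomplex R := realbc 2^-1 * (1 - jj).

Definition dag3 w : bicomplex R := Bicomplex (conjc (bc1 w)) (- conjc (bc2 w)).

Definition hyp_nonneg w : Prop :=
  exists x1 x2 : R, [/\ 0 <= x1, 0 <= x2 &
    w = ee1 * realbc x1 + ee2 * realbc x2].

Definition norm1bc w : R :=
  `|complex.Re (bc1 w)| + `|complex.Im (bc1 w)| + (`|complex.Re (bc2 w)| + `|complex.Im (bc2 w)|).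

Lemma realbcD x y : realbc (x + y) = realbc x + realbc y.
Proof. by congr Bicomplex; apply/eqP; rewrite eq_complex /= addr0 !eqxx. Qed.

Lemma realbcM x y : realbc (x * y) = realbc x * realbc y.
Proof.
by congr Bicomplex; rewrite ?(mulr0, mul0r, subr0, addr0) // rmorphM.
Qed.

Lemma norm1bcD v w : norm1bc (v + w) <= norm1bc v + norm1bc w.
Proof.
case: v w => [[a b] [c d]] [[a' b'] [c' d']]; rewrite /norm1bc /=.
rewrite [leRHS]addrACA; apply: lerD; rewrite [leRHS]addrACA;
  by apply: lerD; apply: ler_normD.
Qed.

Lemma norm1bcZ x w : norm1bc (realbc x * w) = `|x| * norm1bc w.
Proof.
case: w => [[a b] [c d]]; rewrite /norm1bc /=.
by rewrite !(mul0r, oppr0, subr0, addr0, add0r) !normrM !mulrDr.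
Qed.

Lemma norm1bc_ge0 w : 0 <= norm1bc w.
Proof. by rewrite !addr_ge0. Qed.

Lemma norm1bc_eq0 w : norm1bc w = 0 -> w = 0.
Proof.
case: w => [[a b] [c d]] /eqP; rewrite /norm1bc /=.
rewrite !paddr_eq0 ?addr_ge0 // !normr_eq0.
by case/andP=> /andP[/eqP-> /eqP->] /andP[/eqP-> /eqP->].
Qed.

End BicomplexRing.

Definition lin_indep (R : realType) (M : lmodType (bicomplex R)) (n : nat)
    (b : 'I_n -> M) : Prop :=
  forall c : 'I_n -> bicomplex R, \sum_i c i *: b i = 0 -> forall i, c i = 0.

Definition generating (R : realType) (M : lmodType (bicomplex R)) (n : nat)
    (b : 'I_n -> M) : Prop :=
  forall x : M, exists c : 'I_n -> bicomplex R, x = \sum_i c i *: b i.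

Definition ket_basis (R : realType) (M : lmodType (bicomplex R)) (n : nat)
    (b : 'I_n -> M) : Prop := lin_indep b /\ generating b.

(* [ketspace bB] is M seen as a finite-dimensional real vector space with its
   usual topology, given here by the l1 norm of the 4n real coordinates in the
   basis b; all norms on M being equivalent, the topology does not depend
   on b. *)
Definition ketspace (R : realType) (M : lmodType (bicomplex R)) (n : nat)
  (b : 'I_n -> M) (bB : ket_basis b) : Type := M.

Section KetSpace.
Variables (R : realType) (M : lmodType (bicomplex R)) (n : nat).
Variables (b : 'I_n -> M) (bB : ket_basis b).

Definition ket_coord (x : M) : 'I_n -> bicomplex R := sval (cid (bB.2 x)).

Lemma ket_coordP x : x = \sum_i ket_coord x i *: b i.
Proof. exact: svalP (cid (bB.2 x)). Qed.

Lemma ket_coord_uniq x c : x = \sum_i c i *: b i -> ket_coord x =1 c.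
Proof.
move=> xE i; apply/eqP; rewrite -subr_eq0; apply/eqP.
apply: (bB.1 (fun i => ket_coord x i - c i)).
under eq_bigr do rewrite scalerBl.
by rewrite sumrB -ket_coordP -xE subrr.
Qed.

HB.instance Definition _ := GRing.Zmodule.copy (ketspace bB) M.

Definition ket_rscale (r : R) (x : ketspace bB) : ketspace bB :=
  realbc r *: (x : M).

Lemma ket_rscaleA r s x : ket_rscale r (ket_rscale s x) = ket_rscale (r * s) x.
Proof. by rewrite /ket_rscale scalerA realbcM. Qed.
Lemma ket_rscale1 : left_id 1 ket_rscale.
Proof. by move=> x; rewrite /ket_rscale scale1r. Qed.
Lemma ket_rscaleDr : right_distributive ket_rscale +%R.
Proof. by move=> r x y; rewrite /ket_rscale scalerDr. Qed.
Lemma ket_rscaleDl x : {morph ket_rscale^~ x : r s / r + s}.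
Proof. by move=> r s; rewrite /ket_rscale realbcD scalerDl. Qed.

HB.instance Definition _ := GRing.Zmodule_isLmodule.Build R (ketspace bB)
  ket_rscaleA ket_rscale1 ket_rscaleDr ket_rscaleDl.

Definition ket_norm (x : ketspace bB) : R := \sum_i norm1bc (ket_coord x i).

Lemma ket_normD x y : ket_norm (x + y) <= ket_norm x + ket_norm y.
Proof.
rewrite /ket_norm -big_split /=; apply: ler_sum => i _.
rewrite (@ket_coord_uniq _ (fun i => ket_coord x i + ket_coord y i)).
  exact: norm1bcD.
under eq_bigr do rewrite scalerDl.
by rewrite big_split -!ket_coordP.
Qed.

Lemma ket_normZ r x : ket_norm (r *: x) = `|r| * ket_norm x.
Proof.
rewrite /ket_norm mulr_sumr; apply: eq_bigr => i _.
rewrite (@ket_coord_uniq _ (fun i => realbc r * ket_coord x i)) ?norm1bcZ //.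
under eq_bigr do rewrite -scalerA.
by rewrite -scaler_sumr -ket_coordP.
Qed.

Lemma ket_norm_eq0 x : ket_norm x = 0 -> x = 0.
Proof.
move=> /eqP; rewrite psumr_eq0 => [/allP x0|i _]; last exact: norm1bc_ge0.
rewrite [LHS]ket_coordP big1 // => i _.
by rewrite (norm1bc_eq0 (eqP (x0 i (mem_index_enum i)))) scale0r.
Qed.

HB.instance Definition _ := Lmodule_isNormed.Build R (ketspace bB)
  ket_normD ket_normZ ket_norm_eq0.

(* The operator series is summed ket by ket; on a finite-dimensional module this
   agrees with convergence in the space of operators. [limn] is the genuine sum
   only when [op_exp_cvg A] holds. *)
Definition op_exp_psum (A : {linear M -> M}) (x : M) (N : nat) : ketspace bB :=
  x + \sum_(1 <= k < N) (k`!%:R^-1 : R) *: (iter k A x : ketspace bB).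

Definition op_exp_cvg (A : {linear M -> M}) : Prop :=
  forall x : M, cvgn (op_exp_psum A x).

Definition op_exp (A : {linear M -> M}) (x : M) : ketspace bB :=
  limn (op_exp_psum A x).

Definition schrodinger_solution (hbar : R) (H : {linear M -> M})
    (psi : R -> ketspace bB) : Prop :=
  forall t : R, derivable psi t 1 /\
    (ii1 R * realbc hbar) *: (psi^`()%classic t : M) = H (psi t).

Definition evol_gen (hbar : R) (H : {linear M -> M}) (t t0 : R) : {linear M -> M} :=
  (- (ii1 R * realbc hbar^-1) * realbc (t - t0)) \*: H.

Definition evol (hbar : R) (H : {linear M -> M}) (t t0 : R) : M -> ketspace bB :=
  op_exp (evol_gen hbar H t t0).

End KetSpace.

Section ScalarProduct.
Variables (R : realType) (M : lmodType (bicomplex R)).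

Record bc_scalar_product (sp : M -> M -> bicomplex R) : Prop := {
  sp_add : forall x y z, sp x (y + z) = sp x y + sp x z;
  sp_scale : forall x (a : bicomplex R) y, sp x (a *: y) = a * sp x y;
  sp_dag : forall x y, sp x y = dag3 (sp y x);
  sp_def : forall x, sp x x = 0 <-> x = 0
}.

Definition hyperbolic_positive (sp : M -> M -> bicomplex R) : Prop :=
  forall x, hyp_nonneg (sp x x).

Definition is_adjoint (sp : M -> M -> bicomplex R) (A B : {linear M -> M}) :
  Prop := forall x y, sp x (A y) = sp (B x) y.

Lemma is_adjoint_uniq sp (A B B' : {linear M -> M}) : bc_scalar_product sp ->
  is_adjoint sp A B -> is_adjoint sp A B' -> B =1 B'.
Proof.
move=> spP AB AB' x; apply/eqP; rewrite -subr_eq0; apply/eqP.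
apply/(sp_def spP); set d := B x - B' x.
rewrite (sp_add spP) -scaleN1r (sp_scale spP) [sp d (B x)](sp_dag spP).
by rewrite [sp d (B' x)](sp_dag spP) -AB -AB' mulN1r subrr.
Qed.

(* H^* = H, the adjoint being unique by [is_adjoint_uniq]. *)
Definition self_adjoint (sp : M -> M -> bicomplex R) (H : {linear M -> M}) :
  Prop := is_adjoint sp H H.

End ScalarProduct.

(* Main.v *)
(* In real coordinates, M is a finite-dimensional normed space and the equation
   reads psi' = B psi with B = -(i1/hbar) H, a bounded R-linear map. Each
   coordinate of exp(s B) x is an everywhere convergent real power series in s,
   so it may be differentiated termwise, which gives existence. A difference d
   of two solutions satisfies |g'| <= K g for g the sum of the squares of its
   coordinates, so Gronwall's inequality gives d = 0. *)
Require Import Defs.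
From HB Require Import structures.
From mathcomp Require Import all_boot all_order all_algebra.
From mathcomp Require Import all_classical all_reals all_analysis.
From mathcomp Require Import complex ring lra.

Set Implicit Arguments.
Unset Strict Implicit.
Unset Printing Implicit Defensive.

Import Order.TTheory GRing.Theory Num.Theory.
Import numFieldNormedType.Exports.

Local Open Scope classical_set_scope.
Local Open Scope ring_scope.

(** * Continuity and derivatives in real normed spaces *)

Lemma lipschitz_linear_continuous (R : realType) (V W : normedModType R)
    (L : {linear V -> W}) (C : R) :
  (forall x, `|L x| <= C * `|x|) -> continuous L.
Proof.
move=> LC; apply: bounded_linear_continuous; apply/linear_boundedP.
near=> r => x; apply: le_trans (LC x) _.
by rewrite ler_wpM2r//; near: r; exact: nbhs_pinfty_ge.
Unshelve. all: by end_near. Qed.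

(** Difference quotients commute with [L], and continuity of [L] passes to the limit. *)
Lemma is_derive_linear (R : realType) (V W : normedModType R)
    (L : V -> W) (f : R -> V) (t : R) (df : V) :
  linear L -> continuous L -> is_derive t 1 f df -> is_derive t 1 (L \o f) (L df).
Proof.
move=> Llin Lc [fd fE].
have LB x y : L (x - y) = L x - L y.
  by rewrite addrC -scaleN1r Llin scaleN1r addrC.
have LZ r x : L (r *: x) = r *: L x.
  by rewrite -[r *: x]addr0 Llin -(subrr x) LB subrr addr0.
have : h^-1 *: ((L \o f) (h *: 1 + t) - (L \o f) t) @[h --> 0^'] --> L df.
  rewrite [X in X @ _ --> _](_ : _ =
      L \o (fun h => h^-1 *: (f (h *: 1 + t) - f t))); last first.
    by apply/funext => r /=; rewrite LZ LB.
  apply: continuous_cvg; first exact: Lc.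
  rewrite -fE; exact: fd.
move=> Lf; split; first by apply/cvg_ex; exists (L df).
exact: cvg_lim Lf.
Qed.

Lemma is_derive_translate (R : realType) (V : normedModType R) (f : R -> V)
    (t a : R) (df : V) :
  is_derive (t - a) 1 f df -> is_derive t 1 (fun u => f (u - a)) df.
Proof.
have E : (fun h : R => h^-1 *: (f (h *: 1 + t - a) - f (t - a))) =
    (fun h : R => h^-1 *: (f (h *: 1 + (t - a)) - f (t - a))).
  by apply/funext => h; rewrite addrA.
by case=> fd fE; split; rewrite /derivable /derive /= E.
Qed.

Lemma is_derive_bigsum (R : realType) (V : normedModType R) (I : Type)
    (s : seq I) (f : I -> R -> V) (df : I -> V) (t : R) :
  (forall i, is_derive t 1 (f i) (df i)) ->
  is_derive t 1 (fun u => \sum_(i <- s) f i u) (\sum_(i <- s) df i).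
Proof.
move=> fd; elim: s => [|i s IH].
  under eq_fun do rewrite big_nil.
  by rewrite big_nil; exact: is_derive_cst.
under eq_fun do rewrite big_cons.
by rewrite big_cons; exact: is_deriveD.
Qed.

(* [g exp(-K t)] is nonincreasing and [g exp(K t)] nondecreasing. *)
Lemma gronwall_eq0 (R : realType) (g dg : R -> R) (K t0 : R) :
  (forall t : R, is_derive t 1 g (dg t)) -> (forall t, 0 <= g t) ->
  (forall t, `|dg t| <= K * g t) -> g t0 = 0 -> forall t, g t = 0.
Proof.
move=> gd g0 dgK gt0 t; apply/eqP; rewrite eq_le g0 andbT.
have dh (k u : R) : is_derive u 1 (fun s => g s * expR (k * s))
    ((dg u + k * g u) * expR (k * u)).
  have gdu := gd u.
  by apply: is_derive_eq; rewrite /GRing.scale /=; ring.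
have mvt (k a b0 : R) : a <= b0 -> exists u, g b0 * expR (k * b0) -
    g a * expR (k * a) = (dg u + k * g u) * expR (k * u) * (b0 - a).
  move=> ab; have [|u _ hE] := @MVT_segment _ _ _ _ _ ab (fun u _ => dh k u).
    by apply: derivable_within_continuous => u _; exact: ex_derive.
  by exists u.
(* Both products vanish at [t0]: the nondecreasing one is nonpositive before [t0], the nonincreasing
   one after it. *)
have [tt0|/ltW t0t] := leP t t0.
- have [u] := mvt K _ _ tt0; rewrite gt0 mul0r sub0r => hE.
  rewrite -(pmulr_lle0 _ (expR_gt0 (K * t))) -oppr_ge0 hE.
  rewrite !mulr_ge0 ?expR_ge0 ?subr_ge0//.
  by have := dgK u; rewrite ler_norml => /andP[]; lra.
- have [u] := mvt (- K) _ _ t0t; rewrite gt0 mul0r subr0 => hE.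
  rewrite -(pmulr_lle0 _ (expR_gt0 (- K * t))) hE.
  rewrite !mulr_le0_ge0 ?expR_ge0 ?subr_ge0//.
  by have := dgK u; rewrite ler_norml => /andP[]; lra.
Qed.

(** * Exponential series and linear differential equations in finite dimension *)

Section FiniteDimensionalExponential.
Variables (R : realType) (V : normedModType R) (I : finType).
Variables (e : I -> V) (c : I -> {linear V -> R^o}).
Hypothesis ceE : forall x, x = \sum_i c i x *: e i.
Hypothesis c_le : forall i x, `|c i x : R| <= `|x|.

Lemma coord_continuous i : continuous (c i).
Proof.
by apply: (@lipschitz_linear_continuous _ _ _ _ 1) => x; rewrite mul1r; exact: c_le.
Qed.

(** Expanding [x] along the [e i], with coordinates at most [|x|], leaves only the images of the
    [e i] to bound. *)
Lemma findim_bounded (B : {linear V -> V}) :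
  exists2 C : R, 0 <= C & forall x, `|B x| <= C * `|x|.
Proof.
exists (\sum_i `|B (e i)|) => [|x]; first exact: sumr_ge0.
rewrite {1}(ceE x) linear_sum (le_trans (ler_norm_sum _ _ _))// mulr_suml.
by apply: ler_sum => i _; rewrite linearZ normrZ mulrC ler_wpM2l// c_le.
Qed.

Lemma findim_continuous (B : {linear V -> V}) : continuous B.
Proof. by have [C _] := findim_bounded B; exact: lipschitz_linear_continuous. Qed.

Variable B : {linear V -> V}.

Definition exp_term (t : R) (x : V) (k : nat) : V :=
  (t ^+ k / k`!%:R) *: iter k B x.

(** Power series coefficients in [t] of the [i]-th coordinate of exp(tB)x. *)
Let coef i x k : R := c i (iter k B x) / k`!%:R.

(** Since (k+1)/(k+1)! = 1/k!, formal differentiation only applies [B] once more to the vector. *)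
Let coefD i x : pseries_diffs (coef i x) = coef i (B x).
Proof.
apply/funext => k; rewrite /pseries_diffs /coef -iterSr factS natrM invfM.
by rewrite mulrCA mulVKf.
Qed.

(** The terms are dominated by those of [|x|] exp(C[|t|]), where [C] bounds [B]. *)
Let coef_cvg i x t : cvgn (pseries (coef i x) t).
Proof.
have [C C0 BC] := findim_bounded B.
have iterB k : `|iter k B x| <= C ^+ k * `|x|.
  elim: k => [|k IH]; first by rewrite expr0 mul1r.
  by rewrite iterS exprS -mulrA (le_trans (BC _))// ler_wpM2l.
apply: normed_cvg.
apply: (@series_le_cvg _ _ (fun k => C ^+ k * `|x| / k`!%:R * `|t| ^+ k)).
- by move=> k /=.
- by move=> k; rewrite !mulr_ge0// ?exprn_ge0 ?invr_ge0.
- move=> k /=; rewrite !normrM normfV [`|k`!%:R|]ger0_norm// normrX.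
  by rewrite !ler_wpM2r// ?exprn_ge0 ?invr_ge0// (le_trans (c_le _ _)).
- rewrite [X in series X](_ : _ = `|x| *: exp_coeff (C * `|t|)).
    by apply: is_cvg_seriesZ; exact: is_cvg_series_exp_coeff.
  apply/funext => k; change (C ^+ k * `|x| / k`!%:R * `|t| ^+ k =
    `|x| * ((C * `|t|) ^+ k / k`!%:R)).
  by rewrite exprMn; ring.
Qed.

(** This reduces convergence in [V] to that of finitely many real power series. *)
Let exp_term_coord t x : series (exp_term t x) =
  fun N => \sum_i pseries (coef i x) t N *: e i.
Proof.
apply/funext => N; rewrite [LHS]ceE; apply: eq_bigr => i _; congr (_ *: _).
rewrite /series /pseries /= /series linear_sum /=; apply: eq_bigr => k _.
rewrite linearZ_LR /coef; set z : R := c i _.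
by change (t ^+ k / k`!%:R * z = z / k`!%:R * t ^+ k); ring.
Qed.

Let exp_cvg_to t x :
  series (exp_term t x) @ \oo --> \sum_i limn (pseries (coef i x) t) *: e i.
Proof.
rewrite exp_term_coord; apply: cvg_big => [|i _]; first exact: add_continuous.
by apply: cvgZr_tmp; exact: coef_cvg.
Qed.

Lemma is_cvg_exp_term t x : cvgn (series (exp_term t x)).
Proof. by apply/cvg_ex; eexists; exact: exp_cvg_to. Qed.

Lemma exp_term_derive (t : R) (x : V) :
  is_derive t 1 (fun u => limn (series (exp_term u x)))
    (B (limn (series (exp_term t x)))).
Proof.
have limE u y : limn (series (exp_term u y)) =
    \sum_i limn (pseries (coef i y) u) *: e i.
  exact: cvg_lim (@exp_cvg_to u y).
(* [B] is continuous and commutes with its iterates, so it moves inside the sum onto [x]; this is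
   the form that [coefD] yields coordinatewise. *)
have -> : B (limn (series (exp_term t x))) = limn (series (exp_term t (B x))).
  apply/esym/cvg_lim => //.
  have -> : series (exp_term t (B x)) = B \o series (exp_term t x).
    apply/funext => N; rewrite /series /= linear_sum; apply: eq_bigr => k _.
    by rewrite /exp_term linearZ_LR -iterS -iterSr.
  apply: continuous_cvg; first exact: findim_continuous.
  exact: is_cvg_exp_term.
rewrite limE; under eq_fun do rewrite limE.
apply: is_derive_bigsum => i.
apply: (@is_derive_linear _ R^o V ( *:%R^~ (e i))).
- by move=> r u v; rewrite scalerDl scalerA.
- by move=> r; exact: scalel_continuous.
(* Any radius beyond [|t|] would do: by [coefD] the first and second formal derivatives are again
   series of type [coef], convergent everywhere. *)
- rewrite -coefD; apply: (@pseries_snd_diffs _ _ (`|t| + 1)); rewrite ?coefD//.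
  by rewrite [ltRHS]ger0_norm ?ltrDl// addr_ge0.
Qed.

(** The norm need not be differentiable along [d], whereas the sum of squared coordinates is, so
    Gronwall is applied to the latter. *)
Lemma linear_ode_eq0 (d : R -> V) (t0 : R) :
  (forall t : R, is_derive t 1 d (B (d t))) -> d t0 = 0 -> forall t, d t = 0.
Proof.
move=> dd dt0 t.
have [C C0 BC] := findim_bounded B.
pose S := \sum_i `|e i|.
pose y i u : R := c i (d u).
pose dy i u : R := c i (B (d u)).
have yd i (u : R) : is_derive u 1 (y i) (dy i u).
  exact: (@is_derive_linear R V R (c i) d u _ (linearP (c i))
    (coord_continuous (i := i)) (dd u)).
suff g0 : \sum_i y i t ^+ 2 = 0.
  rewrite (ceE (d t)) big1// => i _.
  have /eqP := g0; rewrite psumr_eq0 => [/allP|j _]; last exact: sqr_ge0.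
  move=> /(_ i (mem_index_enum i)); rewrite sqrf_eq0 => /eqP yi0.
  by rewrite [c i (d t)]yi0 scale0r.
have dyB i u : `|dy i u| <= \sum_j C * `|e j| * `|y j u|.
  rewrite (le_trans (c_le _ _))// (le_trans (BC _))//.
  under eq_bigr do rewrite -mulrA; rewrite -mulr_sumr ler_wpM2l//.
  rewrite {1}(ceE (d u)) (le_trans (ler_norm_sum _ _ _))//.
  by apply: ler_sum => j _; rewrite normrZ mulrC.
(* Each 2[|y i||dy i|] is at most the sum over j of CS(y_i^2 + y_j^2); summing over i counts every
   square 2[#|I|] times. *)
pose K := C * S * (#|I|%:R *+ 2).
apply: (@gronwall_eq0 _ (fun u => \sum_i y i u ^+ 2)
   (fun u => \sum_i 2 * (y i u * dy i u)) K t0) => [u|u|u|].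
- apply: is_derive_bigsum => i; have yiu := yd i u.
  by apply: is_derive_eq; rewrite /GRing.scale /=; ring.
- by apply: sumr_ge0 => i _; exact: sqr_ge0.
- rewrite (le_trans (ler_norm_sum _ _ _))//.
  apply: (@le_trans _ _
      (\sum_i \sum_j C * S * (y i u ^+ 2 + y j u ^+ 2))); last first.
    under eq_bigr do rewrite -mulr_sumr big_split /= sumr_const.
    rewrite -mulr_sumr big_split /= sumr_const sumrMnl /K.
    by rewrite -[leRHS]mulrA mulrnAl mulr_natl mulr2n.
  apply: ler_sum => i _; rewrite !normrM ger0_norm// mulrA.
  apply: (le_trans (ler_wpM2l _ (dyB i u))); first by rewrite mulr_ge0.
  rewrite mulr_sumr; apply: ler_sum => j _.
  rewrite mulrCA; apply: ler_pM => //; rewrite ?mulr_ge0//.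
    rewrite ler_wpM2l// /S (bigD1 j)//= lerDl; exact: sumr_ge0.
  (* This gives 2ab <= a^2 + b^2 for the absolute values. *)
  have := sqr_ge0 (`|y i u| - `|y j u|).
  by rewrite -(real_normK (num_real (y i u))) -(real_normK (num_real (y j u))); lra.
- by apply: big1 => i _; rewrite /y dt0 linear0 expr0n.
Qed.

End FiniteDimensionalExponential.

(** * Bicomplex numbers in real coordinates *)

Section BicomplexRealCoordinates.
Variable R : realType.
Implicit Types (p : bool * bool) (w : bicomplex R).

Definition bc_rcoord p w : R :=
  let z := if p.1 then bc2 w else bc1 w in
  if p.2 then complex.Im z else complex.Re z.

(** The real basis 1, [ii1], [ii2], [jj]. *)
Definition bc_unit p : bicomplex R :=
  let z : R[i] := if p.2 then 'i%C else 1 in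
  if p.1 then Bicomplex 0 z else Bicomplex z 0.

Lemma bc_rcoordE w : w = \sum_p realbc (bc_rcoord p w) * bc_unit p.
Proof.
rewrite -(pair_bigA _ (fun a a' => realbc (bc_rcoord (a, a') w) *
  bc_unit (a, a'))) /= !big_bool /=.
case: w => [[a b] [a' b']]; congr Bicomplex; simpc; congr Complex => /=; ring.
Qed.

Lemma bc_rcoord_linear p r v w :
  bc_rcoord p (realbc r * v + w) = r * bc_rcoord p v + bc_rcoord p w.
Proof.
case: v w => [[a b] [a' b']] [[c d] [c' d']].
by case: p => -[] [] /=; rewrite /bc_rcoord /=; ring.
Qed.

Lemma bc_rcoord_le p w : `|bc_rcoord p w| <= norm1bc w.
Proof.
case: w => [[a b] [a' b']]; rewrite /norm1bc /bc_rcoord /=.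
have := (normr_ge0 a, normr_ge0 b, normr_ge0 a', normr_ge0 b').
by case: p => -[] [] /= [] [] []; lra.
Qed.

End BicomplexRealCoordinates.

(** * Kets and operators over the reals *)

Section KetSpaceOperators.
Variables (R : realType) (M : lmodType (bicomplex R)) (n : nat).
Variables (b : 'I_n -> M) (bB : ket_basis b).

Definition ket_rcoord (i : 'I_n * (bool * bool)) (x : ketspace bB) : R^o :=
  bc_rcoord i.2 (ket_coord bB x i.1).

Lemma ket_rcoord_linear i : linear (ket_rcoord i).
Proof.
move=> r x y; rewrite /ket_rcoord.
rewrite (@ket_coord_uniq _ _ _ _ bB _
  (fun i => realbc r * ket_coord bB x i + ket_coord bB y i)).
  exact: bc_rcoord_linear.
under eq_bigr do rewrite scalerDl -scalerA.
by rewrite big_split -scaler_sumr -!ket_coordP.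
Qed.

HB.instance Definition _ i := GRing.isLinear.Build R (ketspace bB) R^o *:%R
  (ket_rcoord i) (ket_rcoord_linear i).

Definition ket_rbasis (i : 'I_n * (bool * bool)) : ketspace bB :=
  bc_unit R i.2 *: b i.1.

Lemma ket_rcoordE x : x = \sum_i ket_rcoord i x *: ket_rbasis i.
Proof.
rewrite [LHS](ket_coordP bB) -(pair_bigA _ (fun j p =>
  ket_rcoord (j, p) x *: ket_rbasis (j, p))) /=.
apply: eq_bigr => j _; rewrite {1}[ket_coord bB x j]bc_rcoordE scaler_suml.
by apply: eq_bigr => p _; rewrite -scalerA.
Qed.

Lemma ket_rcoord_le i x : `|ket_rcoord i x : R| <= `|x|.
Proof.
apply: le_trans (bc_rcoord_le _ _) _.
rewrite [leRHS]/Num.norm /= /ket_norm (bigD1 i.1)//= lerDl.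
by apply: sumr_ge0 => j _; exact: norm1bc_ge0.
Qed.

(** The same map under a name that can carry an R-linear structure beside its bicomplex one. *)
Definition ket_op (A : {linear M -> M}) : ketspace bB -> ketspace bB := A.

Lemma ket_op_linear A : linear (ket_op A).
Proof. by move=> r x y; rewrite /ket_op linearP. Qed.

HB.instance Definition _ A := GRing.isLinear.Build R (ketspace bB) (ketspace bB)
  *:%R (ket_op A) (ket_op_linear A).

End KetSpaceOperators.

(** * The evolution operator and the Schrodinger equation *)

Section Evolution.
Variables (R : realType) (M : lmodType (bicomplex R)) (n : nat).
Variables (b : 'I_n -> M) (bB : ket_basis b).
Variables (hbar : R) (H : {linear M -> M}).

Definition schrodinger_op : {linear M -> M} :=
  (- (ii1 R * realbc hbar^-1)) \*: H.

Let B : {linear ketspace bB -> ketspace bB} := ket_op (bB := bB) schrodinger_op.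

(** Bicomplex scalars commute with each other and with [H], so the time factor comes out of every
    iterate. *)
Lemma iter_evol_gen t t0 k (x : M) :
  iter k (evol_gen hbar H t t0) x =
  realbc ((t - t0) ^+ k) *: iter k schrodinger_op x.
Proof.
elim: k => [|k IH]; first by rewrite expr0 scale1r.
rewrite !iterS IH linearZ_LR /= !scalerA exprS realbcM; congr (_ *: _).
by ring.
Qed.

(** The index must be positive: at 0 the left partial sum already contains the identity term [x],
    while the series is still 0. *)
Lemma op_exp_psumS t t0 (x : M) N :
  op_exp_psum bB (evol_gen hbar H t t0) x N.+1 =
  series (exp_term B (t - t0) x) N.+1.
Proof.
rewrite /op_exp_psum /series /= [in RHS]big_ltn//; congr (_ + _).
  by rewrite /exp_term expr0 fact0 divr1 scale1r.
apply: eq_bigr => k _; rewrite iter_evol_gen /exp_term mulrC -scalerA.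
by congr (_ *: _).
Qed.

(** Shifting by one discards index 0, the only one where the sequences can differ. *)
Lemma op_exp_psum_cvg t t0 (x : M) (l : set_system (ketspace bB)) :
  (op_exp_psum bB (evol_gen hbar H t t0) x @ \oo --> l) =
  (series (exp_term B (t - t0) x) @ \oo --> l).
Proof.
rewrite -cvg_shiftS -[in RHS]cvg_shiftS.
by under eq_fun do rewrite op_exp_psumS.
Qed.

Lemma op_exp_cvg_evol t t0 : op_exp_cvg bB (evol_gen hbar H t t0).
Proof.
move=> x; apply/cvg_ex; exists (limn (series (exp_term B (t - t0) x))).
rewrite op_exp_psum_cvg.
exact: (is_cvg_exp_term (@ket_rcoordE _ _ _ _ bB) (@ket_rcoord_le _ _ _ _ bB)).
Qed.

Lemma evolE t t0 (x : M) :
  evol bB hbar H t t0 x = limn (series (exp_term B (t - t0) x)).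
Proof.
apply: cvg_lim => //; rewrite op_exp_psum_cvg.
exact: (is_cvg_exp_term (@ket_rcoordE _ _ _ _ bB) (@ket_rcoord_le _ _ _ _ bB)).
Qed.

Lemma evol_id t0 (x : M) : evol bB hbar H t0 t0 x = x.
Proof.
(* From index 1 on the partial sums are constantly [x], as 0^k = 0 for k > 0; at index 0 the sum is
   empty. *)
rewrite evolE subrr; apply: cvg_lim => //; rewrite -cvg_shiftS.
rewrite [X in X @ _ --> _](_ : _ = cst (x : ketspace bB)); first exact: cvg_cst.
apply/funext => N /=; rewrite /series /= big_ltn// big1_seq ?addr0.
  by rewrite /exp_term expr0 fact0 divr1 scale1r.
move=> [|k]; rewrite mem_index_iota// => _.
by rewrite /exp_term expr0n mul0r scale0r.
Qed.

Lemma evol_derive (t t0 : R) (x : M) :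
  is_derive t 1 (fun u => evol bB hbar H u t0 x) (B (evol bB hbar H t t0 x)).
Proof.
under eq_fun do rewrite evolE; rewrite evolE.
apply: (is_derive_translate (f := fun u => limn (series (exp_term B u x)))).
exact: (exp_term_derive (@ket_rcoordE _ _ _ _ bB) (@ket_rcoord_le _ _ _ _ bB)).
Qed.

Hypothesis hbar_neq0 : hbar != 0.

Let ihbarK : (ii1 R * realbc hbar) * - (ii1 R * realbc hbar^-1) = 1.
Proof.
rewrite mulrN mulrACA -realbcM divff//; congr Bicomplex; simpc.
- by congr Complex; ring.
- by congr Complex; ring.
Qed.

(** The factor i1 hbar is invertible by [ihbarK], so the equation can be solved for the
    derivative. *)
Lemma schrodinger_solutionP (psi : R -> ketspace bB) :
  schrodinger_solution hbar H psi <->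
  forall t : R, is_derive t 1 psi (B (psi t)).
Proof.
split=> sol t; have [psid psiE] := sol t.
- split=> //; rewrite -derive1E /B /= /ket_op /= -psiE scalerA mulrC ihbarK.
  by rewrite scale1r.
- split=> //; rewrite derive1E psiE /B /= /ket_op /= scalerA ihbarK.
  by rewrite scale1r.
Qed.

Lemma schrodinger_solution_evol t0 (x : M) :
  schrodinger_solution hbar H (fun t => evol bB hbar H t t0 x).
Proof. by apply/schrodinger_solutionP => t; exact: evol_derive. Qed.

Lemma schrodinger_solution_unique (psi : R -> ketspace bB) (t0 t : R) :
  schrodinger_solution hbar H psi -> psi t = evol bB hbar H t t0 (psi t0).
Proof.
move=> /schrodinger_solutionP sol; apply/eqP; rewrite -subr_eq0; apply/eqP.
(* By linearity [d] solves the same equation, and it vanishes at [t0] by [evol_id]. *)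
pose d u : ketspace bB := psi u - evol bB hbar H u t0 (psi t0).
apply: (linear_ode_eq0 (@ket_rcoordE _ _ _ _ bB) (@ket_rcoord_le _ _ _ _ bB)
  (B := B) (d := d) (t0 := t0)); last by rewrite /d evol_id subrr.
by move=> u; rewrite linearB; exact: is_deriveB (sol u) (evol_derive u t0 _).
Qed.

End Evolution.

Theorem theorem5p8 (R : realType) (M : lmodType (bicomplex R)) (n : nat)
    (b : 'I_n -> M) (bB : ket_basis b)
    (sp : M -> M -> bicomplex R) (spP : bc_scalar_product sp)
    (sp_pos : hyperbolic_positive sp)
    (H : {linear M -> M}) (H_sa : self_adjoint sp H)
    (hbar t0 : R) (hbar_gt0 : 0 < hbar) :
  [/\ forall t : R, op_exp_cvg bB (evol_gen hbar H t t0),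
      forall psi0 : M,
        schrodinger_solution hbar H (fun t : R => evol bB hbar H t t0 psi0) /\
        evol bB hbar H t0 t0 psi0 = psi0
    & forall psi : R -> ketspace bB, schrodinger_solution hbar H psi ->
        forall t : R, psi t = evol bB hbar H t t0 (psi t0)].
Proof.
have hbar_neq0 := lt0r_neq0 hbar_gt0.
split=> [t|psi0|psi sol t].
- exact: op_exp_cvg_evol.
- by split; [exact: schrodinger_solution_evol|exact: evol_id].
- exact: schrodinger_solution_unique.
Qed.
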